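(* Let $T$ be an operator semigroup on a set $D$, let $S$ be a $T$-space, let $T^{\#}=\operatorname{Aut}_T(S)$, and let $$T_{\operatorname{Aut}(S)}=\{f:D\to D \mid \operatorname{Im}(f|_S)\subseteq S,\ \sigma(f(a))=f(\sigma(a))\ \forall a\in S,\ \sigma\in\operatorname{Aut}_T(S)\}.$$ (a) $T^{\#}$ is an operator semigroup on $S$, $S$ is a $T^{\#}$-space, and $T_{\operatorname{Aut}(S)}$ is an operator semigroup on $D$. (b) If for all $f\in T$, $f|_S$ is bijective onto $S$, then $\operatorname{Aut}_{T^{\#}}(S)\supseteq T|_S$. (c) Suppose that for all $f\in T_{\operatorname{Aut}(S)}$, $f|_S$ is bijective onto $S$. Then $\operatorname{Aut}_{T^{\#}}(S)\supseteq T|_S$, and equality holds if and only if $T|_S=T_{\operatorname{Aut}(S)}|_S$.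
   Context: An operator semigroup on a set $D$ is a (possibly empty) set $T$ of functions $D\to D$ closed under composition. For $U\subseteq D$, $\langle U\rangle_T=\{f(u):f\in T,u\in U\}$; a $T$-space is a subset of $D$ of this form. (If $S$ is a $T$-space then $f(S)\subseteq S$ for all $f\in T$.) A $T$-morphism from a $T$-space $S$ to a $T$-space is a map $\sigma$ with $\sigma(f(a))=f(\sigma(a))$ for all $a\in S$, $f\in T$; $\operatorname{Aut}_T(S)$ is the set of all bijective $T$-morphisms from $S$ to $S$. For a set $F$ of functions $D\to D$ and $S\subseteq D$, $F|_S=\{f|_S:f\in F\}$, where functions on $S$ with image in $S$ are regarded as functions $S\to S$. *)

(* Defs.v *)
From mathcomp Require Import all_boot all_classical.

Set Implicit Arguments.
Unset Strict Implicit.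
Unset Printing Implicit Defensive.

Local Open Scope classical_set_scope.

Definition operator_semigroup (D : Type) (T : set (D -> D)) : Prop :=
  forall f g, T f -> T g -> T (f \o g).

Definition generated (D : Type) (T : set (D -> D)) (U : set D) : set D :=
  [set f u | f in T & u in U].

Definition is_space (D : Type) (T : set (D -> D)) (S : set D) : Prop :=
  exists U : set D, S = generated T U.

Lemma space_stable (D : Type) (T : set (D -> D)) (S : set D) :
  operator_semigroup T -> is_space T S -> forall f, T f -> set_fun S S f.
Proof.
move=> Tsg [U ->] f Tf _ [g Tg [u Uu <-]].
by exists (f \o g); [exact: Tsg | exists u].
Qed.

(* sigma (f a) = f (sigma a) for all a in S.  Since sigma is only defined on
   the subtype S, the value f a is represented by the element b of S
   it equals; such a b always exists when f maps S into S. *)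
Definition commutes_with (D : Type) (S S' : set D) (sigma : S -> S')
    (f : D -> D) : Prop :=
  forall a b : S, val b = f (val a) -> val (sigma b) = f (val (sigma a)).

Definition is_morphism (D : Type) (T : set (D -> D)) (S S' : set D)
    (sigma : S -> S') : Prop :=
  forall f, T f -> commutes_with sigma f.

Definition Aut (D : Type) (T : set (D -> D)) (S : set D) : set (S -> S) :=
  [set sigma | bijective sigma /\ is_morphism T sigma].
Arguments Aut [D] T S _.

(* When the ambient set is S itself, automorphisms of the full subset live on
   the type [set: S]; this is their transport along the canonical bijection
   between [set: S] and S. *)
Definition of_full (S : Type) (sigma : [set: S] -> [set: S]) : S -> S :=
  val \o sigma \o to_setT.

Definition Aut_full (S : Type) (T : set (S -> S)) : set (S -> S) :=
  [set of_full sigma | sigma in Aut T [set: S]].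

Definition T_Aut (D : Type) (T : set (D -> D)) (S : set D) : set (D -> D) :=
  [set f | set_fun S S f /\
           forall sigma, Aut T S sigma -> commutes_with sigma f].
Arguments T_Aut [D] T S _.

(* F|_S, for a family F of functions mapping S into S, as functions S -> S. *)
Definition restr (D : Type) (F : set (D -> D)) (S : set D) : set (S -> S) :=
  [set g | exists2 f, F f & forall a : S, val (g a) = f (val a)].
Arguments restr [D] F S _.

Lemma restr_val (D : Type) (F : set (D -> D)) (S : set D) :
  (forall f, F f -> set_fun S S f) ->
  [set (val \o g : S -> D) | g in restr F S] =
  [set (f \o val : S -> D) | f in F].
Proof.
move=> FS; apply/seteqP; split=> [_ [g [f Ff gf] <-]|_ [f Ff <-]].
  by exists f => //; apply/funext => a /=; rewrite gf.
have fS (a : S) : f (val a) \in S.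
  by apply/mem_set/(FS f Ff)/set_mem; exact: (valP a).
by exists (fun a => SigSub (fS a)) => //; exists f.
Qed.

(* Main.v *)
Require Import Defs.
From mathcomp Require Import all_boot all_classical.

(** Everything reduces to commutation of self-maps of S.  Call g : S -> S a
    centralizing map when it commutes with every sigma in Aut T S.

    A self-map f of D that stabilizes S commutes with sigma exactly when its
    restriction to S does ([commutes_with_restr]).  As a T-space is stable
    under T, every f in T therefore restricts to a centralizing map, by the very
    definition of Aut T S.  The family T_Aut T S is the largest one with this
    property: its restriction to S consists of all centralizing maps
    ([restr_T_AutP]), because a self-map of S can be extended by the identity
    outside S.  On the other side, the
    automorphisms of S relative to Aut T S are the bijective centralizing maps
    ([Aut_fullP]).

    Bijectivity is therefore the only difference between the two families.  If
    the members of T are bijective on S, their restrictions are automorphisms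
    relative to Aut T S.  If all members of T_Aut T S are bijective on S, the
    two families coincide ([Aut_full_Aut]); the criterion for equality in (c)
    is then the substitution of one for the other.  The closure properties in
    (a) are direct, and S is generated by itself under Aut T S because Aut T S
    contains the identity. *)

Local Open Scope classical_set_scope.

Section Restriction.
Context {D : Type} {S : set D}.
Implicit Types (f : D -> D) (g sigma : S -> S) (T F : set (D -> D)).

Lemma set_fun_val f (a : S) : set_fun S S f -> S (f (val a)).
Proof. by move=> fS; apply: fS; exact: set_mem (valP a). Qed.

Lemma stable_restriction f : set_fun S S f ->
  exists g, forall a, val (g a) = f (val a).
Proof.
move=> fS.
by exists (fun a => SigSub (mem_set (set_fun_val f a fS))).
Qed.

(** The total map needed to see g as a restriction: g on S, and the identity
    elsewhere, which keeps S stable. *)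
Lemma extend_by_id g :
  exists2 f, set_fun S S f & forall a, val (g a) = f (val a).
Proof.
exists (fun x => if insub x is Some a then val (g a) else x) => [x Sx|a].
  by rewrite (insubT (mem S) (mem_set Sx)); exact: set_mem (valP _).
by rewrite valK.
Qed.

(** The element b in the definition of [commutes_with] is forced to be g a,
    which turns that relational condition into an equation between maps. *)
Lemma commutes_with_restr f g sigma : (forall a, val (g a) = f (val a)) ->
  commutes_with sigma f <-> forall a, sigma (g a) = g (sigma a).
Proof.
move=> gf; split=> [sf a|gs a b].
  by apply: val_inj; rewrite gf (sf a (g a)).
by rewrite -!gf => /val_inj ->; rewrite gs.
Qed.

Lemma bijective_restr f g : (forall a, val (g a) = f (val a)) ->
  set_bij S S f -> bijective g.
Proof.
move=> gf [_ finj fsurj]; rewrite -setTT_bijective; split=> //.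
- move=> a b _ _ gab; apply: val_inj.
  apply: finj; [exact: valP a | exact: valP b | by rewrite -!gf gab].
- move=> b _; have [x Sx fx] := fsurj _ (set_mem (valP b)).
  exists (SigSub (mem_set Sx)) => //.
  by apply: val_inj; rewrite gf.
Qed.

Lemma bijective_restr_family F g : (forall f, F f -> set_bij S S f) ->
  restr F S g -> bijective g.
Proof. by move=> Fbij [f Ff gf]; exact: bijective_restr gf (Fbij f Ff). Qed.

Lemma restrS F G : F `<=` G -> restr F S `<=` restr G S.
Proof. by move=> FG g [f Ff gf]; exists f => //; exact: FG. Qed.

(** Extension by the identity makes every centralizing map of S visible on D,
    so T_Aut T S restricts to the full centralizer of Aut T S. *)
Lemma restr_T_AutP T g :
  restr (T_Aut T S) S g <->
  forall sigma, Aut T S sigma -> forall a, sigma (g a) = g (sigma a).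
Proof.
split=> [[f [_ fA] gf] sigma sA|gA].
  exact/(commutes_with_restr _ _ _ gf)/fA.
have [f fS gf] := extend_by_id g.
exists f => //; split=> // sigma sA.
exact/(commutes_with_restr _ _ _ gf)/gA.
Qed.

Lemma sub_T_Aut T : (forall f, T f -> set_fun S S f) -> T `<=` T_Aut T S.
Proof. by move=> TS f Tf; split=> [|sigma [_]]; [exact: TS | exact]. Qed.

Lemma Aut_id T : Aut T S id.
Proof. by split=> [|f _ a b]; [exists id | ]. Qed.

(** Stability of S is what makes composition work: an intermediate value
    f (sigma a) has to be represented in S before the second morphism can be
    applied. *)
Lemma Aut_comp T : (forall f, T f -> set_fun S S f) ->
  operator_semigroup (Aut T S).
Proof.
move=> TS s t [sb sT] [tb tT]; split=> [|f Tf]; first exact: bij_comp.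
have [g gf] := stable_restriction f (TS f Tf).
have /(commutes_with_restr _ _ _ gf) gs := sT f Tf.
have /(commutes_with_restr _ _ _ gf) gt := tT f Tf.
apply/(commutes_with_restr _ _ _ gf) => a /=.
by rewrite gt gs.
Qed.

Lemma T_Aut_comp T : operator_semigroup (T_Aut T S).
Proof.
move=> f h [fS fA] [hS hA]; split=> [x Sx|sigma sA a b ba].
  exact/fS/hS.
have [g gh] := stable_restriction h hS.
rewrite /= -(hA _ sA a (g a)) ?gh //.
by apply: (fA _ sA); rewrite gh.
Qed.

End Restriction.

(** On the full subset every image sigma a is represented, by to_setT, so the
    morphism condition becomes plain commutation with G: the automorphisms are
    the bijections in the centralizer of G. *)
Lemma Aut_fullP (S : Type) (G : set (S -> S)) (g : S -> S) :
  Aut_full G g <->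
  bijective g /\ forall sigma, G sigma -> forall a, sigma (g a) = g (sigma a).
Proof.
have valTK (a : [set: S]) : to_setT (val a) = a by exact: val_inj.
split=> [[phi [[psi phiK psiK] phiG] <-]|[[h gK hK] gG]].
- split=> [|sigma Gs a].
    exists (of_full psi) => a; rewrite /of_full /= valTK.
    + by rewrite phiK.
    + by rewrite psiK.
  by symmetry; apply: (phiG sigma Gs (to_setT a) (to_setT (sigma a))).
- exists (to_setT \o g \o val); last exact/funext.
  split=> [|sigma Gs a b /= ->]; last by rewrite gG.
  exists (to_setT \o h \o val) => a; apply: val_inj => /=.
  + by rewrite gK.
  + by rewrite hK.
Qed.

Lemma restr_sub_Aut_full (D : Type) (T F : set (D -> D)) (S : set D) :
  F `<=` T_Aut T S -> (forall f, F f -> set_bij S S f) ->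
  restr F S `<=` Aut_full (Aut T S).
Proof.
move=> FA Fbij g Fg; apply/Aut_fullP; split.
  exact: bijective_restr_family Fbij Fg.
exact/restr_T_AutP/(restrS _ _ FA).
Qed.

Lemma Aut_full_Aut (D : Type) (T : set (D -> D)) (S : set D) :
  (forall f, T_Aut T S f -> set_bij S S f) ->
  Aut_full (Aut T S) = restr (T_Aut T S) S.
Proof.
move=> bijA; apply/seteqP; split; last exact: restr_sub_Aut_full.
by move=> g /Aut_fullP[_ /restr_T_AutP].
Qed.

Theorem theorem18p0p2 (D : Type) (T : set (D -> D)) (S : set D)
    (hT : operator_semigroup T) (hS : is_space T S) :
  [/\ operator_semigroup (Aut T S),
      is_space (Aut T S) [set: S] &
      operator_semigroup (T_Aut T S)]
  /\
  ((forall f, T f -> set_bij S S f) ->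
    restr T S `<=` Aut_full (Aut T S))
  /\
  ((forall f, T_Aut T S f -> set_bij S S f) ->
    restr T S `<=` Aut_full (Aut T S) /\
    (Aut_full (Aut T S) = restr T S <-> restr T S = restr (T_Aut T S) S)).
Proof.
have TS := space_stable hT hS.
have TA := sub_T_Aut _ TS.
split; [split|split=> [Tbij|Abij]].
- exact: Aut_comp.
- exists setT; apply/seteqP; split=> // a _.
  by exists id; [exact: Aut_id | exists a].
- exact: T_Aut_comp.
- exact: restr_sub_Aut_full.
- rewrite Aut_full_Aut //; split; first exact: restrS.
  by split=> ->.
Qed.
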